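(* Let $k\ge 1$ and let $F=\bigcup_{i=1}^{k}P_{p_i}$ be the vertex-disjoint union of paths $P_{p_1},\dots,P_{p_k}$, where $p_i\ge 2$ for $1\le i\le k$ and at least one $p_i$ is even. Then, for fixed $F$ and $n\to\infty$, $$ar(K_n,F)=\left(\sum_{i=1}^{k}\left\lfloor\frac{p_i}{2}\right\rfloor-2\right)n+O(1).$$
   Context: $P_m$ denotes the path on $m$ vertices. A subgraph of an edge-colored graph is rainbow if all its edges receive distinct colors. For a graph $G$, $ar(K_n,G)$ is the maximum number of colors in an edge-coloring of $K_n$ containing no rainbow copy of $G$. The $O(1)$ term denotes a quantity bounded in absolute value by a constant depending only on $F$. *)

(* Defs.v *)
From Stdlib Require Import Classical.
From mathcomp Require Import all_boot.

Set Implicit Arguments.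
Unset Strict Implicit.
Unset Printing Implicit Defensive.

Record sgraph := SGraph {
  vertex :> finType;
  adj : rel vertex;
  adj_sym : symmetric adj;
  adj_irr : irreflexive adj }.

Definition edges (G : sgraph) : {set {set G}} :=
  [set [set u.1; u.2] | u : G * G & adj u.1 u.2].

Section Complete.
Variable n : nat.
Definition complete_adj : rel 'I_n := fun u v => u != v.
Fact complete_sym : symmetric complete_adj.
Proof. by move=> u v; rewrite /complete_adj eq_sym. Qed.
Fact complete_irr : irreflexive complete_adj.
Proof. by move=> u; rewrite /complete_adj eqxx. Qed.
Definition complete_graph : sgraph := SGraph complete_sym complete_irr.
End Complete.

Section Path.
Variable m : nat.
Definition path_adj : rel 'I_m := fun u v => (u.+1 == v) || (v.+1 == u).
Fact path_sym : symmetric path_adj.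
Proof. by move=> u v; rewrite /path_adj orbC. Qed.
Fact path_irr : irreflexive path_adj.
Proof. by move=> u; rewrite /path_adj orbb gtn_eqF. Qed.
Definition path_graph : sgraph := SGraph path_sym path_irr.
End Path.

Section DisjointUnion.
Variables (I : finType) (G : I -> sgraph).
(* [tagged_as u v] is the vertex [v] read in the component of [u], which is
   only meaningful when the two components agree. *)
Definition union_adj : rel {i : I & G i} :=
  fun u v => (tag u == tag v) && adj (tagged u) (tagged_as u v).
Fact union_sym : symmetric union_adj.
Proof.
move=> [i x] [j y]; rewrite /union_adj /=.
case: (eqVneq i j) => [ij|nij] //=.
by case: _ / ij y => y; rewrite !tagged_asE adj_sym.
Qed.
Fact union_irr : irreflexive union_adj.
Proof. by move=> [i x]; rewrite /union_adj tagged_asE adj_irr andbF. Qed.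
Definition disjoint_union : sgraph := SGraph union_sym union_irr.
End DisjointUnion.

Definition linear_forest (k : nat) (p : 'I_k -> nat) : sgraph :=
  disjoint_union (fun i => path_graph (p i)).

(* Only the values on [edges H] matter; [nat] provides enough colors for any
   finite graph. *)
Definition edge_coloring (H : sgraph) := {set H} -> nat.

Definition num_colors (H : sgraph) (c : edge_coloring H) : nat :=
  size (undup [seq c e | e in edges H]).

(* A copy of [G] in [H] (as a not necessarily induced subgraph) is the image
   of an embedding. *)
Definition embedding (G H : sgraph) (f : G -> H) : Prop :=
  injective f /\ forall u v, adj u v -> adj (f u) (f v).

Definition rainbow (G H : sgraph) (c : edge_coloring H) (f : G -> H) : Prop :=
  {in edges G &, injective (fun e : {set G} => c (f @: e))}.

Definition rainbow_free (G H : sgraph) (c : edge_coloring H) : Prop :=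
  ~ exists f : G -> H, embedding f /\ rainbow c f.

(* [is_anti_ramsey n G a] states that [a] is the value of ar(K_n, G). It is a
   relation because the maximum need not exist: every coloring of K_n, n >= 2,
   contains a rainbow copy of P_2. By [anti_ramsey_exists] the maximum does
   exist as soon as [G] has two edges. *)
Definition is_anti_ramsey (n : nat) (G : sgraph) (a : nat) : Prop :=
  (exists c : edge_coloring (complete_graph n),
      rainbow_free G c /\ num_colors c = a) /\
  (forall c : edge_coloring (complete_graph n),
      rainbow_free G c -> num_colors c <= a).

Lemma is_anti_ramsey_uniq n G a b :
  is_anti_ramsey n G a -> is_anti_ramsey n G b -> a = b.
Proof.
move=> [[c [fc <-]] maxa] [[d [fd <-]] maxb].
by apply/eqP; rewrite eqn_leq maxb ?maxa.
Qed.

Lemma anti_ramsey_exists n (G : sgraph) :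
  1 < #|edges G| -> exists a, is_anti_ramsey n G a.
Proof.
move=> /card_gt1P[e1 [e2 [e1G e2G ne12]]].
pose P a := exists c : edge_coloring (complete_graph n),
  rainbow_free G c /\ a <= num_colors c.
have P0 : P 0.
  exists (fun=> 0); split=> // -[f [_ rf]].
  by move/eqP: ne12; apply; apply: rf.
have Pb : ~ P #|edges (complete_graph n)|.+1.
  move=> [c [_]]; apply/negP; rewrite -leqNgt.
  by rewrite (leq_trans (size_undup _)) ?size_image.
elim: #|edges (complete_graph n)|.+1 Pb => [|m IH] Pm; first by case: Pm.
case: (classic (P m)) => [[c [fc mc]]|]; last exact: IH.
have max (d : edge_coloring (complete_graph n)) : rainbow_free G d -> num_colors d <= m.
  by move=> fd; rewrite leqNgt; apply/negP=> md; apply: Pm; exists d.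
exists m; split=> //; exists c; split=> //.
by apply/eqP; rewrite eqn_leq mc max.
Qed.

(* Main.v *)
(* Let s be the sum of the floors p_i/2.

Lower bound: give the edges meeting a fixed set of s - 2 vertices pairwise
distinct colors and all other edges one further color. F has a matching of size
s, at most one edge of which avoids the fixed set in a rainbow copy.

Upper bound: say that v owns a color when all its edges contain v. If some vertex
owns at most s - 2 colors, delete it; so it suffices that a coloring in which each
of n >= n0 vertices owns at least s - 1 colors contains a rainbow F. Choose s - 1
arcs out of every vertex v, with distinct colors owned by v; any set of arcs is
then rainbow, and the color of an edge xy can only coincide with that of an arc
out of x or y. A Delta-system argument, followed by a minimal choice of the set
A of hubs, yields many disjoint out-balls ("pieces") avoiding A, each with an arc
to every hub. Put h = min(|A|, s - 1) and j = s - h. Inside a piece a greedy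
out-walk visits j vertices, so a path through u > 0 hubs can have 2(j + u) - 1
vertices, and one edge joining the ends of two out-walks of j vertices lengthens
one component by j more. These lengths suffice for F, because one p_i is even. *)
Require Import Defs.
From mathcomp Require Import all_boot all_order all_algebra zify.

Set Implicit Arguments.
Unset Strict Implicit.
Unset Printing Implicit Defensive.

(** * Delta-systems of sets of bounded size *)

Lemma card_bigcup_le (I V : finType) (P : {set I}) (F : I -> {set V}) m :
  {in P, forall i, #|F i| <= m} -> #|\bigcup_(i in P) F i| <= #|P| * m.
Proof.
move=> Fm; rewrite -sum_nat_const.
elim/big_rec2: _ => [|i y B iP IH]; first by rewrite cards0.
rewrite cardsU (leq_trans (leq_subr _ _)) // leq_add //; exact: Fm.
Qed.

(** Induction on [K]. A maximal family of disjoint sets [S x] either has [M] members, and then [A]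
    is empty, or its small union [U] meets all the other sets; then some [u] in [U] lies in many of
    them and moves into [A]. *)
Lemma delta_system K M : exists n0, forall (V : finType) (I : {set V}) (S : V -> {set V}),
  {in I, forall x, #|S x| <= K} -> n0 <= #|I| ->
  exists A X : {set V}, [/\ #|A| <= K, X \subset I, M <= #|X| &
    {in X &, forall x y, x != y -> [disjoint S x :\: A & S y :\: A]}].
Proof.
elim: K => [|K [n0 IH]].
  exists M => V I S SK MI; exists set0, I; split=> //; first by rewrite cards0.
  move=> x y xI yI _; have := SK x xI; rewrite leqn0 cards_eq0 => /eqP->.
  by rewrite set0D disjoints_subset sub0set.
(* If both cases failed, [I] would consist of fewer than [M] members of [Y] and of fewer than [n0]
   indices for each of at most [M * K.+1] points of [U]. *)
exists (M + M * K.+1 * n0).+1 => V I S SK MI.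
pose P (Y : {set V}) := (Y \subset I) &&
  [forall x in Y, forall y in Y, (x != y) ==> [disjoint S x & S y]].
have [Y /maxsetP[/andP[YI /forall_inP Yd] Ymax]] : {Y | maxset P Y}.
  apply: ex_maxset; exists set0; rewrite /P sub0set /=.
  by apply/forall_inP => x; rewrite inE.
have {}Yd x y : x \in Y -> y \in Y -> x != y -> [disjoint S x & S y].
  by move=> xY yY; move/forall_inP: (Yd x xY) => /(_ y yY)/implyP; apply.
have [MY|YM] := leqP M #|Y|.
  exists set0, Y; split=> //; first by rewrite cards0.
  by move=> x y xY yY; rewrite !setD0; apply: Yd.
pose U := \bigcup_(y in Y) S y.
have cardU : #|U| <= M * K.+1.
  apply: (@leq_trans (#|Y| * K.+1)); last by rewrite leq_mul // ltnW.
  by apply: card_bigcup_le => y yY; apply: SK; apply: (subsetP YI).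
have meetU x : x \in I -> x \notin Y -> exists2 u, u \in U & u \in S x.
  move=> xI xY; case: (pickP [pred u in U | u \in S x]) => [u /andP[uU uS]|no].
    by exists u.
  have xU y : y \in Y -> [disjoint S x & S y].
    move=> yY; apply/pred0P => u /=; apply/negP => /andP[ux uy].
    have := no u; rewrite /= ux andbT => /negP; apply.
    by apply/bigcupP; exists y.
  case/negP: xY; rewrite -(Ymax (x |: Y)) ?setU11 ?subsetUr //.
  rewrite /P subUset sub1set xI YI /=.
  apply/forall_inP => y /setU1P yY; apply/forall_inP => z /setU1P zY.
  apply/implyP; case: yY => [->|yY]; case: zY => [->|zY]; rewrite ?eqxx // => yz.
  - exact: xU.
  - by rewrite disjoint_sym xU.
  - exact: Yd.
pose Iu u := [set x in I | u \in S x].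
have [/existsP[u /andP[uU n0u]]|/existsPn small] :=
  boolP [exists u, (u \in U) && (n0 <= #|Iu u|)].
  have [x|//|A [X [AK XI MX dX]]] := IH V (Iu u) (fun x => S x :\ u).
    rewrite inE => /andP[xI xu]; have := SK x xI.
    by rewrite (cardsD1 u) xu add1n ltnS.
  exists (u |: A), X; split=> //.
  - by rewrite cardsU1; case: (u \notin A); lia.
  - apply: subset_trans XI _; apply/subsetP => x; by rewrite inE => /andP[].
  - by move=> x y xX yX xy; rewrite -!setDDl; apply: dX.
have IU : I \subset Y :|: \bigcup_(u in U) Iu u.
  apply/subsetP => x xI; rewrite inE; case: (boolP (x \in Y)) => //= xY.
  have [u uU ux] := meetU x xI xY; apply/bigcupP; exists u => //.
  by rewrite inE xI.
have := subset_leq_card IU; rewrite leqNgt => /negP[].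
apply: leq_trans MI; rewrite ltnS cardsU (leq_trans (leq_subr _ _)) //.
apply: leq_add; first exact: ltnW.
apply: (@leq_trans (#|U| * n0)); last by rewrite leq_mul2r cardU orbT.
apply: card_bigcup_le => u uU; apply: ltnW.
by have := small u; rewrite uU /= -ltnNge.
Qed.

(** * Out-balls in a digraph from which the hubs are removed *)

Section OutBalls.
Variables (V : finType) (N : V -> {set V}).

(** The out-ball of radius [r] around [x] in the digraph [N] with [A] removed; only the center may
    lie in [A]. *)
Fixpoint reach (A : {set V}) (r : nat) (x : V) : {set V} :=
  if r is r'.+1
  then reach A r' x :|: (\bigcup_(y in reach A r' x) N y) :\: A
  else [set x].

Definition touches A r x a := [exists q in reach A r x, a \in N q].

Definition arc_in (Q : {set V}) : rel V :=
  fun u v => [&& u \in Q, v \in Q & (v \in N u) || (u \in N v)].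

Lemma reach0 A r x : x \in reach A r x.
Proof. by elim: r => [|r IH] /=; rewrite !inE ?IH. Qed.

Lemma reach_leq A r r' x : r <= r' -> reach A r x \subset reach A r' x.
Proof.
elim: r' => [|r' IH]; first by rewrite leqn0 => /eqP->.
rewrite leq_eqVlt ltnS => /orP[/eqP->//|/IH h].
exact: subset_trans h (subsetUl _ _).
Qed.

Lemma reach_step A r x q v :
  q \in reach A r x -> v \in N q -> v \notin A -> v \in reach A r.+1 x.
Proof.
move=> qr vq vA /=; rewrite !inE vA; apply/orP; right; apply/bigcupP.
by exists q.
Qed.

Lemma reach_avoid (A : {set V}) r x v : x \notin A -> v \in reach A r x -> v \notin A.
Proof.
move=> xA; elim: r => [|r IH] /=; first by rewrite inE => /eqP->.
by rewrite !inE => /orP[/IH//|/andP[]].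
Qed.

Lemma reach_sub (S A : {set V}) r x :
  {in S, forall v, N v \subset S} -> x \in S -> reach A r x \subset S.
Proof.
move=> NS xS; elim: r => [|r IH] /=; first by rewrite sub1set.
rewrite subUset IH /= (subset_trans (subsetDl _ _)) //.
by apply/bigcupsP => y yr; apply: NS; apply: (subsetP IH).
Qed.

Lemma reach_anti A r x : reach A r x \subset reach set0 r x.
Proof.
elim: r => [|r IH] /=; first exact: subxx.
apply: setUSS => //; rewrite setD0 (subset_trans (subsetDl _ _)) //.
apply/bigcupsP => y yr; apply: (bigcup_max y) => //; exact: (subsetP IH).
Qed.

Lemma reach_card (S : {set V}) d r x :
  {in S, forall v, N v \subset S} -> {in S, forall v, #|N v| <= d} ->
  x \in S -> #|reach set0 r x| <= d.+1 ^ r.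
Proof.
move=> NS Nd xS; elim: r => [|r IH] /=; first by rewrite cards1.
rewrite setD0 cardsU (leq_trans (leq_subr _ _)) // expnSr mulnS.
have h : #|\bigcup_(y in reach set0 r x) N y| <= #|reach set0 r x| * d.
  apply: card_bigcup_le => y yr; apply: Nd.
  exact: (subsetP (reach_sub set0 r NS xS)).
by rewrite leq_add // (leq_trans h) // leq_mul2r IH orbT.
Qed.

Lemma reach_drop A a r x :
  ~~ touches A r x a -> reach (A :\ a) r x = reach A r x.
Proof.
move=> nt; have {}nt q : q \in reach A r x -> a \notin N q.
  by move=> qr; apply: contra nt => aq; apply/existsP; exists q; rewrite qr.
have H r' : r' <= r -> reach (A :\ a) r' x = reach A r' x.
  elim: r' => [//|r' IH] rr /=; rewrite IH ?(ltnW rr) //.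
  congr (_ :|: _); apply/setP => v; rewrite !inE.
  have [->|//] := eqVneq v a.
  suff /negPf -> : a \notin \bigcup_(y in reach A r' x) N y by rewrite !andbF.
  apply/negP => /bigcupP[y yr]; apply/negP/nt.
  exact: (subsetP (reach_leq A x (ltnW rr))).
exact: H.
Qed.

Lemma arc_in_sym Q : symmetric (arc_in Q).
Proof. by move=> u v; rewrite /arc_in andbCA orbC. Qed.

Lemma reach_connect A r x q : q \in reach A r x ->
  connect (arc_in (reach A r x)) x q.
Proof.
have mono r1 r2 : r1 <= r2 -> subrel (connect (arc_in (reach A r1 x)))
    (connect (arc_in (reach A r2 x))).
  move=> rr; apply: connect_sub => u v /and3P[ur vr uv]; apply: connect1.
  by rewrite /arc_in uv !(subsetP (reach_leq A x rr)).
elim: r q => [|r IH] q; first by rewrite inE => /eqP->.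
move=> qr; have := qr; rewrite /= !inE => /orP[qr'|/andP[qA /bigcupP[y yr qy]]].
  exact: (mono r r.+1 (leqnSn r) _ _ (IH q qr')).

apply: connect_trans (mono r r.+1 (leqnSn r) _ _ (IH y yr)) (connect1 _).
by rewrite /arc_in qr qy !andbT; apply: (subsetP (reach_leq A x (leqnSn r))).
Qed.

Lemma reach_path A r x q q' : q \in reach A r x -> q' \in reach A r x ->
  exists w, [/\ path (arc_in (reach A r x)) q w, uniq (q :: w) & last q w = q'].
Proof.
move=> /reach_connect xq /reach_connect xq'.
have : connect (arc_in (reach A r x)) q q'.
  apply: connect_trans xq'; rewrite sym_connect_sym //; exact: arc_in_sym.
by case/connectP => w /shortenP[w' pw' uw' _] ->; exists w'.
Qed.

(** Greedy extension: the last vertex has [d] out-neighbors, and only [A] and the earlier vertices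
    of the walk are forbidden. Each step raises the radius by one. *)
Lemma reach_walk (S A : {set V}) d r x q k :
  {in S, forall v, [/\ N v \subset S, v \notin N v & #|N v| = d]} ->
  x \in S -> q \in reach A r x -> k + #|A| <= d ->
  exists w, [/\ path [rel u v | v \in N u] q w, size w = k, uniq (q :: w) &
    {subset q :: w <= reach A (r + k) x}].
Proof.
move=> HN xS qr; elim: k => [|k IH] kA.
  exists [::]; split=> // v; rewrite inE addn0 => /eqP->//.
have [|w [pw sw uw ws]] := IH; first by apply: leq_trans kA; rewrite addSn.
have [NSs Nirr Nd] : [/\ {in S, forall v, N v \subset S},
   {in S, forall v, v \notin N v} & {in S, forall v, #|N v| = d}].
  by split=> v /HN[].
have yS : last q w \in S.
  by apply: (subsetP (reach_sub A (r + k) NSs xS)); apply: ws; exact: mem_last.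
pose y := last q w.
have [v vN] : exists2 v, v \in N y & v \notin A :|: [set z in q :: w].
  case: (pickP [pred v in N y | v \notin A :|: [set z in q :: w]]) => [v /andP[]|no].
    by exists v.
  (* Since [y] is not its own out-neighbor, a walk of [k] steps blocks only [k] vertices besides
     [A]. *)
  have sub : N y \subset A :|: ([set z in q :: w] :\ y).
    apply/subsetP => v vN; have := no v; rewrite /= vN /= => /negbFE.
    rewrite !inE; case: (v \in A) => //= vw; rewrite vw andbT.
    by apply: contraTneq vN => ->; apply: Nirr.
  have := subset_leq_card sub; rewrite Nd // leqNgt => /negP[].
  have := cardsD1 y [set z in q :: w]; rewrite inE mem_last cardsE.
  rewrite (card_uniqP uw) /= sw add1n => -[ck].
  by apply: leq_trans kA; rewrite cardsU -ck addSn ltnS addnC leq_subr.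
rewrite !inE negb_or => /andP[vA vw].
exists (rcons w v); split.
- by rewrite rcons_path pw.
- by rewrite size_rcons sw.
- by rewrite -rcons_cons rcons_uniq uw inE vw.
- move=> z; rewrite -rcons_cons mem_rcons inE addnS => /orP[/eqP->|/ws zr].
    by apply: reach_step vN vA; apply: ws; exact: mem_last.
  exact: (subsetP (reach_leq A x (leqnSn _))).
Qed.
End OutBalls.

(** * Pieces: disjoint out-balls with access to every hub *)

Section Pieces.
Variables (V : finType) (N : V -> {set V}).

Definition walk_in (j : nat) (Q : {set V}) (q : V) (w : seq V) :=
  [/\ path [rel u v | v \in N u] q w, (size w).+1 = j, uniq (q :: w) &
      {subset q :: w <= Q}].

(** The second clause provides a walk even when [A] is empty. The path between two hubs may use arcs
    in both directions, but the walks are directed: this decides which vertices own the colors near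
    the extra edge. *)
Definition piece (j : nat) (A Q : {set V}) : Prop :=
  [/\ {in A, forall a, a \notin Q},
      exists q w, walk_in j Q q w,
      {in A, forall a, exists q w, walk_in j Q q w /\ a \in N q} &
      {in A &, forall a b, exists q w, [/\ path (arc_in N Q) q w, uniq (q :: w),
         q \in Q, a \in N q & b \in N (last q w)]}].
End Pieces.

(* Each of the first d hubs adds room for a greedy walk of d steps. With more
   hubs the walks are single vertices, so the radius may stay bounded, as the
   Delta-system step requires. *)
Definition radius d h := d * (minn h d).+1.

(** With [h] hubs, discarding at most [stock T h.-1] centers for each hub leaves at least [T] of
    them. *)
Fixpoint stock T h := if h is h'.+1 then T + h * stock T h' else T.

Lemma stock_mono T h h' : h <= h' -> stock T h <= stock T h'.
Proof.
elim: h' => [|h' IH]; first by rewrite leqn0 => /eqP->.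
rewrite leq_eqVlt ltnS => /orP[/eqP->//|/IH h_]; apply: leq_trans h_ _ => /=.
by rewrite mulSn addnCA leq_addr.
Qed.

Lemma radius_mono d h h' : h <= h' -> radius d h <= radius d h'.
Proof. by rewrite /radius leq_mul2l ltnS => hh; lia. Qed.

(** Induction on the number of hubs. A hub missed by many balls of the smaller radius is dropped,
    which leaves those balls unchanged by [reach_drop]; if there is none, the few centers missing
    some hub are discarded. Touching at the radius for one hub less leaves room for a walk from the
    point of contact. *)
Lemma minimal_hubs d T (V : finType) (N : V -> {set V}) h (A X : {set V}) :
  #|A| = h -> stock T h <= #|X| -> {in X, forall x, x \notin A} ->
  {in X &, forall x y, x != y ->
     [disjoint reach N A (radius d h) x & reach N A (radius d h) y]} ->
  exists A' X' : {set V}, [/\ X' \subset X, T <= #|X'|,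
    {in X', forall x, x \notin A'},
    {in X' &, forall x y, x != y ->
     [disjoint reach N A' (radius d #|A'|) x & reach N A' (radius d #|A'|) y]} &
    {in X', forall x, {in A', forall a, touches N A' (radius d #|A'|.-1) x a}}].
Proof.
elim: h A X => [|h IH] A X cA cX XA dX.
  exists A, X; split; rewrite ?cA // => x xX a.
  by move/eqP: cA; rewrite cards_eq0 => /eqP->; rewrite inE.
pose miss a := [set x in X | ~~ touches N A (radius d h) x a].
have [/exists_inP[a aA ma]|/exists_inPn none] :=
  boolP [exists a in A, stock T h <= #|miss a|].
  have missP x : x \in miss a -> x \in X /\
      reach N (A :\ a) (radius d h) x = reach N A (radius d h) x.
    by rewrite inE => /andP[xX nt]; rewrite reach_drop.
  have [|//|||A' [X' [X'm TX' X'A' dX' tX']]] := IH (A :\ a) (miss a).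
  - by move: cA; rewrite (cardsD1 a) aA => -[].
  - by move=> x /missP[xX _]; rewrite !inE (negPf (XA x xX)) andbF.
  - move=> x y /missP[xX ->] /missP[yX ->] xy.
    have sub z := reach_leq N A z (radius_mono d (leqnSn h)).
    apply: disjointWl (sub x) _; apply: disjointWr (sub y) _; exact: dX.
  exists A', X'; split=> //; apply: subset_trans X'm _.
  by apply/subsetP => x; rewrite inE => /andP[].
exists A, (X :\: \bigcup_(a in A) miss a); rewrite cA; split.
- exact: subsetDl.
- rewrite cardsD leq_subRL; last first.
    by apply: subset_leq_card; apply: subsetIl.
  apply: leq_trans cX => /=; rewrite addnC leq_add2l -cA.
  apply: leq_trans (subset_leq_card (subsetIr _ _)) _.
  apply: card_bigcup_le => a aA; apply: ltnW; rewrite ltnNge; exact: none.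
- by move=> x /setDP[xX _]; apply: XA.
- by move=> x y /setDP[xX _] /setDP[yX _]; apply: dX.
- move=> x /setDP[xX xm] a aA; apply: contraNT xm => nt.
  by apply/bigcupP; exists a => //; rewrite inE xX.
Qed.

(** A Delta-system of full out-balls supplies a first set of hubs, and [minimal_hubs] thins it out
    until every ball touches every hub. *)
Lemma pieces_exist d T : exists n0, forall (V : finType) (N : V -> {set V}) (S : {set V}),
  {in S, forall v, [/\ N v \subset S, v \notin N v & #|N v| = d]} ->
  n0 <= #|S| ->
  exists (A X : {set V}) (Q : V -> {set V}) j,
   [/\ 0 < j, j + minn #|A| d = d.+1, T <= #|X|,
      {in X &, forall x y, x != y -> [disjoint Q x & Q y]} &
      {in X, forall x, Q x \subset S /\ piece N j A (Q x)}].
Proof.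
(* [R] bounds every [radius d h], and [K] the size of every out-ball of radius [R], hence also that
   of the kernel [A0]. The summand [K] below makes up for centers that lie in [A0]. *)
pose R := d * d.+1; pose K := d.+1 ^ R.
have [n0 Hn0] := delta_system K (K + stock T K).
exists n0 => V N S HN nS.
have NS : {in S, forall v, N v \subset S} by move=> v /HN[].
have Nd : {in S, forall v, #|N v| <= d} by move=> v /HN[_ _ ->].
have [x xS|//|A0 [X0 [A0K X0S KX0 dX0]]] := Hn0 V S (reach N set0 R).
  exact: reach_card NS Nd xS.
have rR h : radius d h <= R by rewrite leq_mul2l ltnS geq_minr orbT.
have [|||A [X [XX0 TX XA dX tX]]] := @minimal_hubs d T V N #|A0| A0 (X0 :\: A0) erefl.
- apply: leq_trans (stock_mono T A0K) _; rewrite cardsD leq_subRL; last first.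
    by apply: subset_leq_card; apply: subsetIl.
  apply: leq_trans KX0; rewrite leq_add2r (leq_trans _ A0K) //.
  by apply: subset_leq_card; apply: subsetIr.
- by move=> x /setDP[].
- move=> x y /setDP[xX xA] /setDP[yX yA] xy.
  have sub z : z \notin A0 ->
      reach N A0 (radius d #|A0|) z \subset reach N set0 R z :\: A0.
    move=> zA; apply/subsetP => v vr; rewrite inE (reach_avoid zA vr) /=.
    apply: (subsetP (reach_leq N set0 z (rR #|A0|))).
    exact: (subsetP (reach_anti N A0 _ z)).
  apply: disjointWl (sub x xA) _; apply: disjointWr (sub y yA) _; exact: dX0.
pose j := d.+1 - minn #|A| d.
exists A, X, (reach N A (radius d #|A|)), j; split=> //; first by rewrite /j; lia.
  by rewrite /j; lia.
move=> x xX.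
have xS : x \in S by apply: (subsetP X0S); have /setDP[] := subsetP XX0 x xX.
split; first exact: reach_sub.
have wk r q : q \in reach N A r x -> r + (d - minn #|A| d) <= radius d #|A| ->
    exists w, walk_in N j (reach N A (radius d #|A|) x) q w.
  set k := d - _ => qr rk.
  case: (leqP #|A| d) => Ad.
    have [|w [pw sw uw ws]] := reach_walk (k := k) HN xS qr; first by rewrite /k; lia.
    exists w; split=> //; first by rewrite sw /j /k; lia.
    by move=> v /ws; apply: (subsetP (reach_leq N A x rk)).
  (* With more than [d] hubs [j] is 1, and the vertex [q] alone is the walk. *)
  exists [::]; split=> //; first by rewrite /j /=; lia.
  move=> v; rewrite inE => /eqP->.
  apply: (subsetP (reach_leq N A x _)) qr; exact: leq_trans (leq_addr _ _) rk.
(* Up to [d] hubs, each one widens the radius by [d], enough for the [d - #|A|] steps of a walk;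
   beyond that, walks have no steps. *)
have radius_pred a : a \in A -> radius d #|A|.-1 + (d - minn #|A| d) <= radius d #|A|.
  rewrite /radius (cardsD1 a) => ->; rewrite add1n /=.
  case: (leqP #|A :\ a| d) => [h|h]; last by nia.
  by case: (leqP #|A :\ a|.+1 d) => h'; nia.
split.
- move=> a aA; apply/negP => ar.
  by have := reach_avoid (XA x xX) ar; rewrite aA.
- have [|w Hw] := wk 0 x (reach0 _ _ _ _); last by exists x, w.
  by rewrite /radius; nia.
- move=> a aA; have /exists_inP[q qr aq] := tX x xX a aA.
  by have [w Hw] := wk _ q qr (radius_pred a aA); exists q, w.
- move=> a b aA bA.
  have /exists_inP[q qr aq] := tX x xX a aA.
  have /exists_inP[q' qr' bq'] := tX x xX b bA.
  have sub := subsetP (reach_leq N A x (radius_mono d (leq_pred #|A|))).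
  have [w [pw uw lw]] := reach_path (sub q qr) (sub q' qr').
  by exists q, w; rewrite lw; split=> //; apply: sub.
Qed.

(** * Long paths that alternate between hubs and pieces *)

Definition capacity j u := if u is 0 then j else (2 * (j + u)).-1.

Section Assembly.
Variables (V : finType) (N : V -> {set V}) (A X : {set V}) (Q : V -> {set V}).
Variable j : nat.
Hypothesis j_gt0 : 0 < j.
Hypothesis Qdisj : {in X &, forall x y, x != y -> [disjoint Q x & Q y]}.
Hypothesis Qpiece : {in X, forall x, piece N j A (Q x)}.

Definition body (xs : seq V) : {set V} := [set v | has (fun x => v \in Q x) xs].

(** Requiring only the tail to lie in [B] admits the arcs from pieces to hubs. *)
Definition arc_from (B : {set V}) : rel V :=
  fun u v => (u \in B) && (v \in N u) || (v \in B) && (u \in N v).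

Lemma arc_from_sym B : symmetric (arc_from B).
Proof. by move=> u v; rewrite /arc_from orbC. Qed.

Lemma sorted_rev_arc B s : sorted (arc_from B) (rev s) = sorted (arc_from B) s.
Proof.
rewrite rev_sorted; case: s => //= x s; apply: eq_path => u v; exact: arc_from_sym.
Qed.

Lemma arc_from_sub (B B' : {set V}) : {subset B <= B'} -> subrel (arc_from B) (arc_from B').
Proof.
by move=> s u v /orP[]/andP[/s h1 h2]; rewrite /arc_from h1 h2 ?orbT.
Qed.

Lemma bodyP xs v : reflect (exists2 x, x \in xs & v \in Q x) (v \in body xs).
Proof. by rewrite inE; apply: hasP. Qed.

Lemma body_sub xs ys : {subset xs <= ys} -> {subset body xs <= body ys}.
Proof. by move=> s v /bodyP[x /s xy vx]; apply/bodyP; exists x. Qed.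

Lemma same_piece x y v : x \in X -> y \in X -> v \in Q x -> v \in Q y -> x = y.
Proof.
move=> xX yX vx vy; apply/eqP; apply: contraT => xy.
by have /pred0P/(_ v) := Qdisj xX yX xy; rewrite /= vx vy.
Qed.

Lemma body_disj xs ys v : {subset xs <= X} -> {subset ys <= X} ->
  v \in body xs -> v \in body ys -> exists2 x, x \in xs & x \in ys.
Proof.
move=> sx sy /bodyP[x xx vx] /bodyP[y yy vy]; exists x => //.
by rewrite (same_piece (sx x xx) (sy y yy) vx vy).
Qed.

Lemma hub_notin_body xs a : {subset xs <= X} -> a \in A -> a \notin body xs.
Proof.
move=> sx aA; apply/negP => /bodyP[x xx ax].
by have [/(_ a aA)] := Qpiece (sx x xx); rewrite ax.
Qed.

Lemma walk_arc_from (B : {set V}) x q w : {subset Q x <= B} -> walk_in N j (Q x) q w ->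
  path (arc_from B) q w.
Proof.
move=> QB [pw _ _ ws]; have sB v : v \in q :: w -> v \in B by move=> /ws/QB.
elim: w q pw sB {ws} => [//|z w IH] q /= /andP[zq pw] sB.
rewrite IH // ?andbT; last by move=> v vw; apply: sB; rewrite inE vw orbT.
by rewrite /arc_from zq sB ?mem_head.
Qed.

Lemma arc_in_path x q w : path (arc_in N (Q x)) q w -> q \in Q x ->
  {subset q :: w <= Q x}.
Proof.
elim: w q => [|z w IH] q /=; first by move=> _ qx v; rewrite inE => /eqP->.
case/andP => /and3P[_ zx _] pw qx v; rewrite inE => /orP[/eqP->//|].
exact: IH.
Qed.

Lemma arc_in_from (B : {set V}) x : {subset Q x <= B} -> subrel (arc_in N (Q x)) (arc_from B).
Proof.
by move=> QB u v /and3P[/QB ux /QB vx uv]; rewrite /arc_from ux vx.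
Qed.

Lemma body_head x xs v : v \in Q x -> v \in body (x :: xs).
Proof. by move=> vx; apply/bodyP; exists x; rewrite ?mem_head. Qed.

Lemma body_behead x xs v : v \in body xs -> v \in body (x :: xs).
Proof. by apply: body_sub => z zx; rewrite inE zx orbT. Qed.

Arguments body_head {x xs v} _.
Arguments body_behead {x xs v} _.

(** Consecutive hubs are joined through one piece each, and the last hub continues into a walk of
    [j] vertices. Every hub after [a] adds at least two vertices, itself and one of the joining
    path; [a] is not counted in [L]. *)
Lemma spine a hs xs : uniq (a :: hs) -> {subset a :: hs <= A} ->
  uniq xs -> {subset xs <= X} -> size xs = (size hs).+1 ->
  exists L, [/\ path (arc_from (body xs)) a L, uniq (a :: L),
    {subset a :: L <= [predU mem (a :: hs) & mem (body xs)]} &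
    j + 2 * size hs <= size L].
Proof.
elim: hs a xs => [|b hs IH] a [//|x xs] uh hA ux xX [sz].
  have [_ _ tch _] := Qpiece (xX x (mem_head _ _)).
  have aA := hA a (mem_head _ _).
  have [q [w [Hw aq]]] := tch a aA; have [_ sw uw ws] := Hw.
  exists (q :: w); split.
  - rewrite /= (walk_arc_from (@body_head x xs) Hw) andbT.
    by rewrite /arc_from aq (body_head (ws q (mem_head _ _))) orbT.
  - rewrite cons_uniq uw andbT; apply: contra (hub_notin_body xX aA).
    by move=> /ws; apply: body_head.
  - move=> v; rewrite inE => /orP[/eqP->|/ws/body_head vb].
      by rewrite !inE eqxx.
    by rewrite inE /= vb orbT.
  - by rewrite /= sw; lia.
move: ux; rewrite cons_uniq => /andP[xxs ux].
have [aA bA] : a \in A /\ b \in A by split; apply: hA; rewrite !inE eqxx ?orbT.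
have xX' : {subset xs <= X} by move=> v vx; apply: xX; rewrite inE vx orbT.
have [||L [pL uL sL szL]] := IH b xs _ _ ux xX' sz.
  by case/andP: uh.
  by move=> v vh; apply: hA; rewrite inE vh orbT.
have [_ _ _ cn] := Qpiece (xX x (mem_head _ _)).
have [q [w [pw uw qx aq bw]]] := cn a b aA bA.
have ws := arc_in_path pw qx.
have lw : last q w \in Q x by apply: ws; apply: mem_last.
exists ((q :: w) ++ b :: L); split.
- rewrite cat_path /= (sub_path (arc_in_from (@body_head x xs)) pw).
  rewrite (sub_path (arc_from_sub (@body_behead x xs)) pL) !andbT.
  by rewrite /arc_from aq bw (body_head qx) (body_head lw) !orbT.
- rewrite cons_uniq cat_uniq uw uL andbT andTb; apply/andP; split.
    rewrite mem_cat negb_or; apply/andP; split.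
      by apply: contra (hub_notin_body xX aA) => /ws/body_head.
    apply/negP => /sL /orP[/= ah|/= ab].
      by move: uh; rewrite cons_uniq ah.
    by move: (hub_notin_body xX' aA); rewrite ab.
  apply/hasPn => v vL; apply/negP => /= /ws vx.
  case/orP: (sL v vL) => /= vh.
    have vA : v \in A by apply: hA; rewrite inE vh orbT.
    by move: (hub_notin_body xX vA); rewrite (body_head vx).
  case/bodyP: vh => y yx vy; move: xxs.
  by rewrite (same_piece (xX x (mem_head _ _)) (xX' y yx) vx vy) yx.
- move=> v; rewrite inE mem_cat => /or3P[/eqP->|/ws/body_head vb|/sL].
  + by rewrite !inE eqxx.
  + by rewrite inE /= vb orbT.
  + rewrite inE /= => /orP[vh|/(@body_behead x _ _) vb].
      by rewrite inE /= inE vh orbT.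
    by rewrite inE /= vb orbT.
- rewrite size_cat /=; set l := size L in szL *; set h := size hs in szL *; move: szL; clear; lia.
Qed.

(** A reversed walk of [j] vertices leads to the first hub, and a spine follows. With [u > 0] hubs
    this gives [j + 1 + (j + 2 * (u - 1))] vertices, which is [capacity j u]; without hubs a single
    walk gives [j]. *)
Lemma hub_path hs xs : uniq hs -> {subset hs <= A} ->
  uniq xs -> {subset xs <= X} -> size xs = (size hs).+1 ->
  exists L, [/\ sorted (arc_from (body xs)) L, uniq L,
    {subset L <= [predU mem hs & mem (body xs)]} &
    capacity j (size hs) <= size L].
Proof.
case: xs => [//|x xs] uh hA; rewrite cons_uniq => /andP[xxs ux] xX [sz].
have xX' : {subset xs <= X} by move=> v vx; apply: xX; rewrite inE vx orbT.
have [_ [q [w Hw]] tch _] := Qpiece (xX x (mem_head _ _)).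
case: hs uh hA sz => [|a hs] uh hA sz.
  have [_ sw uw ws] := Hw; exists (q :: w); split=> //.
  - exact: (walk_arc_from (@body_head x xs) Hw).
  - by move=> v /ws/body_head vb; apply/orP; right; apply: vb.
  - by rewrite /= sw.
have [L [pL uL sL szL]] := spine uh hA ux xX' sz.
have aA := hA a (mem_head _ _).
have [q' [w' [{}Hw aq]]] := tch a aA; have [_ sw uw ws] := Hw.
exists (rev (q' :: w') ++ a :: L); split.
- rewrite sorted_cat_cons -rev_cons sorted_rev_arc.
  rewrite (sub_path (arc_from_sub (@body_behead x xs)) pL) andbT /=.
  rewrite (walk_arc_from (@body_head x xs) Hw) andbT.
  by rewrite /arc_from aq (body_head (ws q' (mem_head _ _))) orbT.
- rewrite cat_uniq rev_uniq uw uL andbT andTb.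
  apply/hasPn => v vL; apply/negP => /=; rewrite mem_rev => /ws vx.
  case/orP: (sL v vL) => /= vh.
    by move: (hub_notin_body xX (hA v vh)); rewrite (body_head vx).
  case/bodyP: vh => y yx vy; move: xxs.
  by rewrite (same_piece (xX x (mem_head _ _)) (xX' y yx) vx vy) yx.
- move=> v; rewrite mem_cat mem_rev => /orP[/ws/body_head vb|/sL].
    by rewrite inE /= vb orbT.
  case/orP => [vh|/(@body_behead x _ _) vb]; apply/orP; by [left|right].
- rewrite size_cat size_rev /= sw; set l := size L in szL *; set h := size hs in szL *; move: szL; clear; lia.
Qed.

(** * Colors of arcs, and the extra edge *)

Variables (c : {set V} -> nat) (S : {set V}).
Hypothesis NS : {in S, forall v, N v \subset S}.
Hypothesis QS : {in X, forall x, Q x \subset S}.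
Hypothesis c_inj : {in S, forall u, {in N u &, injective (fun v => c [set u; v])}}.
Hypothesis c_own : forall u v x y, u \in S -> v \in N u -> x \in S -> y \in S ->
  x != y -> c [set u; v] = c [set x; y] -> (u == x) || (u == y).
Hypothesis N_irr : {in S, forall v, v \notin N v}.

(** The edges usable beside the extra edge [xy]: that edge and every arc of another color. By
    [link_color_inj] any set of them is rainbow. *)
Definition link (x y : V) : rel V := fun u v => [&& u \in S, v \in S &
  ((v \in N u) || (u \in N v)) && (c [set u; v] != c [set x; y])
  || ([set u; v] == [set x; y])].

Lemma link_sym x y : symmetric (link x y).
Proof. by move=> u v; rewrite /link andbCA orbC [[set u; v]]setUC orbC [(v \in _) || _]orbC. Qed.

Lemma arc_neq u v : u \in S -> v \in N u -> u != v.
Proof. by move=> uS; apply: contraTneq => <-; apply: N_irr. Qed.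

(** If two arcs of equal color have different tails, each tail is an end of the other arc, so they
    are the two orientations of one edge. *)
Lemma arc_color_inj u v u' v' : u \in S -> u' \in S -> v \in N u -> v' \in N u' ->
  c [set u; v] = c [set u'; v'] -> [set u; v] = [set u'; v'].
Proof.
move=> uS uS' vN vN' cE; have [uE|nu] := eqVneq u u'.
  by subst u'; rewrite (c_inj uS vN vN' cE).
have vS := subsetP (NS uS) _ vN; have vS' := subsetP (NS uS') _ vN'.
have := c_own uS vN uS' vS' (arc_neq uS' vN') cE; rewrite (negPf nu) => /eqP->.
have := c_own uS' vN' uS vS (arc_neq uS vN) (esym cE).
by rewrite eq_sym (negPf nu) => /eqP->; rewrite setUC.
Qed.

Lemma link_color_inj x y u v u' v' : link x y u v -> link x y u' v' ->
  c [set u; v] = c [set u'; v'] -> [set u; v] = [set u'; v'].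
Proof.
case/and3P => uS vS /orP[/andP[uv cuv]|/eqP uvE];
  case/and3P => uS' vS' /orP[/andP[uv' cuv']|/eqP uvE'] cE; last 1 first.
- by rewrite uvE uvE'.
- case/orP: uv => uv; case/orP: uv' => uv'.
  + exact: arc_color_inj.
  + by rewrite [RHS]setUC; apply: arc_color_inj => //; rewrite cE setUC.
  + by rewrite [LHS]setUC; apply: arc_color_inj => //; rewrite setUC cE.
  + rewrite [LHS]setUC [RHS]setUC; apply: arc_color_inj => //.
    by rewrite [in LHS]setUC [in RHS]setUC.
- by move: cuv; rewrite cE uvE' eqxx.
- by move: cuv'; rewrite -cE uvE eqxx.
Qed.

(** Within [S] the color of an arc out of [u] occurs only on edges containing [u], so the extra edge
    has another one. *)
Lemma link_arc x y u v : x \in S -> y \in S -> x != y ->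
  u \in S -> v \in N u -> u != x -> u != y -> link x y u v.
Proof.
move=> xS yS xy uS vN ux uy; rewrite /link uS (subsetP (NS uS)) //= vN /=.
apply/orP; left; apply: contraTneq isT => cE.
by have := c_own uS vN xS yS xy cE; rewrite (negPf ux) (negPf uy).
Qed.

Lemma link_arc_from (B : {set V}) x y : B \subset S -> x \in S -> y \in S ->
  x != y -> x \notin B -> y \notin B -> subrel (arc_from B) (link x y).
Proof.
move=> BS xS yS xy xB yB u v.
have nB z : z \in B -> z != x /\ z != y.
  by move=> zB; split; apply: contraTneq zB => ->.
case/orP => /andP[uB uv]; have [ux uy] := nB _ uB.
  by apply: link_arc => //; apply: (subsetP BS).
by rewrite link_sym; apply: link_arc => //; apply: (subsetP BS).
Qed.

(** The tails of the arcs lie in [belast q w], so an end of the extra edge does no harm as the final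
    vertex of the walk. *)
Lemma walk_link x y q w : x \in S -> y \in S -> x != y ->
  path [rel u v | v \in N u] q w -> {subset q :: w <= S} ->
  x \notin belast q w -> y \notin belast q w -> path (link x y) q w.
Proof.
move=> xS yS xy; elim: w q => [//|z w IH] q /= /andP[qz pw] sS.
rewrite !inE !negb_or => /andP[xq xw] /andP[yq yw].
rewrite IH // ?andbT; last by move=> v vw; apply: sS; rewrite inE vw orbT.
by apply: link_arc => //; rewrite 1?eq_sym // sS ?mem_head.
Qed.

Lemma sorted_join (e : rel V) s w t w' : symmetric e ->
  path e s w -> path e t w' -> e (last s w) (last t w') ->
  sorted e ((s :: w) ++ rev (t :: w')).
Proof.
move=> e_sym pw pw' ee; rewrite [t :: w']lastI rev_rcons sorted_cat_cons.
rewrite /= rcons_path pw ee /= rev_path.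
by rewrite (eq_path (e' := e)) // => u v; rewrite e_sym.
Qed.

Lemma last_notin_belast (q : V) w : uniq (q :: w) -> last q w \notin belast q w.
Proof. by rewrite lastI rcons_uniq => /andP[]. Qed.

(** The extra edge joins the two final vertices, which are tails of no arc of either walk. *)
Lemma two_walks x1 x2 q1 w1 q2 w2 : x1 \in X -> x2 \in X -> x1 != x2 ->
  walk_in N j (Q x1) q1 w1 -> walk_in N j (Q x2) q2 w2 ->
  let y1 := last q1 w1 in let y2 := last q2 w2 in
  [/\ [/\ y1 \in S, y2 \in S & y1 != y2], path (link y1 y2) q1 w1,
   path (link y1 y2) q2 w2, link y1 y2 y1 y2 &
   uniq ((q1 :: w1) ++ rev (q2 :: w2))].
Proof.
move=> x1X x2X x12 [p1 s1 u1 i1] [p2 s2 u2 i2] y1 y2.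
have sub1 v : v \in q1 :: w1 -> v \in S by move=> /i1; apply: (subsetP (QS x1X)).
have sub2 v : v \in q2 :: w2 -> v \in S by move=> /i2; apply: (subsetP (QS x2X)).
have disj v : v \in q1 :: w1 -> v \in q2 :: w2 -> False.
  move=> /i1 v1 /i2 v2; move: x12.
  by rewrite (same_piece x1X x2X v1 v2) eqxx.
have y1w : y1 \in q1 :: w1 by apply: mem_last.
have y2w : y2 \in q2 :: w2 by apply: mem_last.
have y1S := sub1 _ y1w; have y2S := sub2 _ y2w.
have y12 : y1 != y2.
  by apply/eqP => E; apply: (disj y1) => //; rewrite E.
split=> //.
- apply: walk_link => //; first exact: last_notin_belast.
  by apply/negP => /mem_belast h; apply: (disj y2).
- apply: walk_link => //; last exact: last_notin_belast.
  by apply/negP => /mem_belast h; apply: (disj y1).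
- by rewrite /link y1S y2S [X in _ || X]eqxx orbT.
- rewrite cat_uniq rev_uniq u1 u2 andbT andTb.
  by apply/hasPn => v; rewrite mem_rev => v2; apply/negP => /= v1; apply: (disj v).
Qed.

(* If the color of the extra edge coincides with that of the arc from the second
   walk to the hub, exchanging the two walks resolves the conflict. *)
Lemma two_walks_hub a x1 x2 : a \in A -> x1 \in X -> x2 \in X -> x1 != x2 ->
  exists z1 z2 q1 w1 q2 w2, [/\ perm_eq [:: z1; z2] [:: x1; x2],
    walk_in N j (Q z1) q1 w1, walk_in N j (Q z2) q2 w2 &
    link (last q1 w1) (last q2 w2) a q2].
Proof.
move=> aA x1X x2X x12.
have [_ _ tch1 _] := Qpiece x1X; have [q1 [w1 [W1 a1]]] := tch1 a aA.
have [_ _ tch2 _] := Qpiece x2X; have [q2 [w2 [W2 a2]]] := tch2 a aA.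
have q1S : q1 \in S.
  by have [_ _ _ i] := W1; apply: (subsetP (QS x1X)); apply: i; rewrite mem_head.
have q2S : q2 \in S.
  by have [_ _ _ i] := W2; apply: (subsetP (QS x2X)); apply: i; rewrite mem_head.
have aS := subsetP (NS q1S) _ a1.
have [E|nE] := eqVneq (c [set a; q2]) (c [set last q1 w1; last q2 w2]); last first.
  by exists x1, x2, q1, w1, q2, w2; split=> //; rewrite /link aS q2S a2 nE orbT.
exists x2, x1, q2, w2, q1, w1; split=> //.
  by rewrite (perm_catC [:: x2] [:: x1]).
rewrite /link aS q1S a1 orbT /= [[set last q2 w2; _]]setUC -E.
(* A second conflict would give both arcs into [a] the color of the extra edge, hence make them
   equal; then [q1 = q2] would lie in two disjoint pieces. *)
apply/orP; left; apply: contra_neq x12 => cE.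
have /setP/(_ q1) : [set q1; a] = [set q2; a].
  by apply: arc_color_inj => //; rewrite setUC cE setUC.
rewrite !inE eqxx /= => /esym/orP[/eqP qE|/eqP qa].
  have [_ _ _ i1] := W1; have [_ _ _ i2] := W2.
  apply: (@same_piece _ _ q1) => //; first by apply: i1; apply: mem_head.
  by rewrite qE; apply: i2; apply: mem_head.
by move: a1 (N_irr q1S); rewrite -qa => ->.
Qed.

(** The path runs through the first walk, the extra edge, the reversed second walk, the first hub
    and a spine: one walk more than in [hub_path], hence [j] more vertices. The spine is safe, as
    the tails of its arcs lie in other pieces; the arc from [q2] to the hub needs
    [two_walks_hub]. *)
Lemma extra_path hs xs : uniq hs -> {subset hs <= A} ->
  uniq xs -> {subset xs <= X} -> size xs = (size hs).+2 ->
  exists y1 y2 L, [/\ [/\ y1 \in S, y2 \in S & y1 != y2],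
    (y1 \in body xs) && (y2 \in body xs), sorted (link y1 y2) L /\ uniq L,
    {subset L <= [predU mem hs & mem (body xs)]} &
    capacity j (size hs) + j <= size L].
Proof.
case: xs => [//|x1 [//|x2 xs]] uh hA /andP[x1n /andP[x2n ux]] xX [sz].
have x12 : x1 != x2 by apply: contraNneq x1n => ->; apply: mem_head.
have x1X : x1 \in X by apply: xX; rewrite !inE eqxx.
have x2X : x2 \in X by apply: xX; rewrite !inE eqxx orbT.
have xX' : {subset xs <= X} by move=> v vx; apply: xX; rewrite !inE vx !orbT.
have inb z : z \in [:: x1; x2] -> {subset Q z <= body [:: x1, x2 & xs]}.
  move=> zx v vz; apply/bodyP; exists z => //.
  by move: zx; rewrite !inE => /orP[]->; rewrite ?orbT.
case: hs uh hA sz => [|a hs] uh hA sz.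
  have [_ [q1 [w1 W1]] _ _] := Qpiece x1X; have [_ [q2 [w2 W2]] _ _] := Qpiece x2X.
  have [ys p1 p2 p12 u12] := two_walks x1X x2X x12 W1 W2.
  have [_ s1 _ i1] := W1; have [_ s2 _ i2] := W2.
  exists (last q1 w1), (last q2 w2), ((q1 :: w1) ++ rev (q2 :: w2)); split=> //.
  - apply/andP; split; first by apply: (inb x1); rewrite ?mem_head ?i1 ?mem_last.
    by apply: (inb x2); rewrite ?inE ?eqxx ?orbT ?i2 ?mem_last.
  - split=> //; apply: sorted_join => //; exact: link_sym.
  - move=> v; rewrite mem_cat mem_rev => /orP[/i1|/i2] vq; apply/orP; right.
      by apply: (inb x1); rewrite ?mem_head.
    by apply: (inb x2); rewrite ?inE ?eqxx ?orbT.
  - by rewrite size_cat size_rev /= s1 s2.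
have aA := hA a (mem_head _ _).
have [z1 [z2 [q1 [w1 [q2 [w2 [pz W1 W2 la]]]]]]] := two_walks_hub aA x1X x2X x12.
have z1x : z1 \in [:: x1; x2] by rewrite -(perm_mem pz) mem_head.
have z2x : z2 \in [:: x1; x2] by rewrite -(perm_mem pz) !inE eqxx orbT.
have zX z : z \in [:: x1; x2] -> z \in X by rewrite !inE => /orP[]/eqP->.
have zxs z : z \in [:: x1; x2] -> z \notin xs.
  rewrite !inE => /orP[]/eqP->//; apply: contra x1n => h; by rewrite inE h orbT.
have z12 : z1 != z2 by have := perm_uniq pz; rewrite /= !inE x12 andbT => ->.
have [ys p1 p2 p12 u12] := two_walks (zX _ z1x) (zX _ z2x) z12 W1 W2.
have [_ s1 _ i1] := W1; have [_ s2 _ i2] := W2.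
have [L [pL uL sL szL]] := spine uh hA ux xX' sz.
have ybody z y : z \in [:: x1; x2] -> y \in Q z -> y \notin body xs.
  move=> zx yz; apply/negP => /bodyP[x xxs yx]; have := zxs _ zx.
  by rewrite (same_piece (zX z zx) (xX' x xxs) yz yx) xxs.
exists (last q1 w1), (last q2 w2), ((q1 :: w1) ++ rev (q2 :: w2) ++ a :: L); split=> //.
- apply/andP; split; first by apply: (inb z1); rewrite ?i1 ?mem_last.
  by apply: (inb z2); rewrite ?i2 ?mem_last.
- split.
    rewrite catA sorted_cat_cons rcons_cat -rev_cons; apply/andP; split.
      apply: sorted_join => //; first exact: link_sym.
      by rewrite /= la.
    have [y1S y2S y12] := ys.
    apply: sub_path pL; apply: link_arc_from => //.
    + by apply/subsetP => v /bodyP[x /xX' xx]; apply: (subsetP (QS xx)).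
    + by apply: (ybody z1) => //; apply: i1; apply: mem_last.
    + by apply: (ybody z2) => //; apply: i2; apply: mem_last.
  rewrite catA cat_uniq u12 uL andbT andTb; apply/hasPn => v vL.
  apply/negP => vw; have {vw} : v \in (q1 :: w1) ++ rev (q2 :: w2) by [].
  rewrite mem_cat mem_rev => vw.
  have [z zx vz] : exists2 z, z \in [:: x1; x2] & v \in Q z.
    by case/orP: vw => [/i1|/i2] h; [exists z1|exists z2].
  case/orP: (sL v vL) => /= vh.
    have [/(_ v (hA v vh)) nv _ _ _] := Qpiece (zX z zx).
    by rewrite vz in nv.
  by move: (ybody z v zx vz); rewrite vh.
- move=> v; rewrite !mem_cat mem_rev => /or3P[/i1|/i2|/sL/orP[vh|vh]].
  + by move=> h; apply/orP; right; apply: (inb z1).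
  + by move=> h; apply/orP; right; apply: (inb z2).
  + by apply/orP; left.
  + by apply/orP; right; do 2 apply: body_behead.
- rewrite !size_cat size_rev /= s1 s2.
  set l := size L in szL *; set h := size hs in szL *; move: szL j_gt0; clear; lia.
Qed.
End Assembly.

(** * Disjoint paths for all components *)

Section Forest.
Variables (V : finType) (N : V -> {set V}) (A X : {set V}) (Q : V -> {set V}).
Variable j : nat.
Hypothesis j_gt0 : 0 < j.
Hypothesis Qdisj : {in X &, forall x y, x != y -> [disjoint Q x & Q y]}.
Hypothesis Qpiece : {in X, forall x, piece N j A (Q x)}.

Definition region (hs xs : seq V) := [predU mem hs & mem (body Q xs)].

Lemma region_split hs xs m n v : uniq hs -> {subset hs <= A} ->
  uniq xs -> {subset xs <= X} ->
  v \in region (take m hs) (take n xs) -> v \in region (drop m hs) (drop n xs) -> False.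
Proof.
move=> uh hA ux xX v1 v2.
have disj (T : eqType) (s : seq T) k z : uniq s -> z \in take k s -> z \in drop k s -> False.
  rewrite -{1}(cat_take_drop k s) cat_uniq => /and3P[_ /hasPn h _] z1 /h.
  by rewrite /= z1.
have tX : {subset take n xs <= X} by move=> z /mem_take/xX.
have dX : {subset drop n xs <= X} by move=> z /mem_drop/xX.
case/orP: v1 => /= v1; case/orP: v2 => /= v2.
- exact: disj uh v1 v2.
- by have := hub_notin_body Qpiece dX (hA _ (mem_take v1)); rewrite v2.
- by have := hub_notin_body Qpiece tX (hA _ (mem_drop v2)); rewrite v1.
- by have [z z1 z2] := body_disj Qdisj tX dX v1 v2; apply: disj ux z1 z2.
Qed.

Lemma region_take hs xs m n : {subset region (take m hs) (take n xs) <= region hs xs}.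
Proof.
move=> v /orP[/= /mem_take h|/= h]; apply/orP; [by left|right].
by apply: body_sub h => z /mem_take.
Qed.

Lemma region_drop hs xs m n : {subset region (drop m hs) (drop n xs) <= region hs xs}.
Proof.
move=> v /orP[/= /mem_drop h|/= h]; apply/orP; [by left|right].
by apply: body_sub h => z /mem_drop.
Qed.

(** Component [i] takes the next [u i] hubs and the next [(u i).+1] pieces from the two lists, so
    the paths lie in disjoint regions. *)
Lemma disjoint_paths (I : eqType) (u p : I -> nat) (l : seq I) hs xs :
  uniq l -> uniq hs -> {subset hs <= A} -> uniq xs -> {subset xs <= X} ->
  \sum_(i <- l) u i <= size hs -> \sum_(i <- l) (u i).+1 <= size xs ->
  {in l, forall i, p i <= capacity j (u i)} ->
  exists P : I -> seq V,
    {in l, forall i, [/\ sorted (arc_from N (body Q xs)) (P i), uniq (P i),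
       p i <= size (P i) & {subset P i <= region hs xs}]} /\
    {in l &, forall i i' v, v \in P i -> v \in P i' -> i = i'}.
Proof.
elim: l hs xs => [|i l IH] hs xs; first by exists (fun=> [::]); split.
rewrite cons_uniq => /andP[il ul] uh hA ux xX; rewrite !big_cons => su sx pc.
have szh : size (take (u i) hs) = u i by rewrite size_takel //; lia.
have szx : size (take (u i).+1 xs) = (u i).+1.
  by rewrite size_takel //; apply: leq_trans sx; apply: leq_addr.
have [|||||L [pL uL sL szL]] := hub_path j_gt0 Qdisj Qpiece
    (hs := take (u i) hs) (xs := take (u i).+1 xs).
- exact: take_uniq.
- by move=> v /mem_take/hA.
- exact: take_uniq.
- by move=> v /mem_take/xX.
- by rewrite szh szx.
have [|||||||P [HP dP]] := IH (drop (u i) hs) (drop (u i).+1 xs) ul.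
- exact: drop_uniq.
- by move=> v /mem_drop/hA.
- exact: drop_uniq.
- by move=> v /mem_drop/xX.
- by rewrite size_drop leq_subRL //; lia.
- rewrite size_drop leq_subRL //; apply: leq_trans sx; exact: leq_addr.
- by move=> i' il'; apply: pc; rewrite inE il' orbT.
have sd i' v : i' \in l -> v \in P i' -> v \notin L.
  move=> il' vP; apply/negP => /sL vL; have [_ _ _ sP] := HP i' il'.
  exact: region_split uh hA ux xX vL (sP v vP).
exists (fun i' => if i' == i then L else P i'); split.
- move=> i'; rewrite inE; case: eqP => [-> _|_ /= il'].
    split=> //.
    + apply: sub_sorted pL; apply: arc_from_sub; apply: body_sub => z; exact: mem_take.
    + by apply: leq_trans szL; rewrite szh; apply: pc; rewrite mem_head.
    + by move=> v /sL; apply: region_take.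
  have [pP uP szP sP] := HP i' il'; split=> //.
    apply: sub_sorted pP; apply: arc_from_sub; apply: body_sub => z; exact: mem_drop.
  by move=> v /sP; apply: region_drop.
- move=> i1 i2; rewrite !inE; case: (i1 =P i) => [-> _|_ /= i1l];
    case: (i2 =P i) => [-> _|_ /= i2l] v //.
  + by move=> vL /(sd _ _ i2l); rewrite vL.
  + by move=> /(sd _ _ i1l)/negPf->.
  + exact: dP.
Qed.

Variables (c : {set V} -> nat) (S : {set V}).
Hypothesis NS : {in S, forall v, N v \subset S}.
Hypothesis QS : {in X, forall x, Q x \subset S}.
Hypothesis c_inj : {in S, forall u, {in N u &, injective (fun v => c [set u; v])}}.
Hypothesis c_own : forall u v x y, u \in S -> v \in N u -> x \in S -> y \in S ->
  x != y -> c [set u; v] = c [set x; y] -> (u == x) || (u == y).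
Hypothesis N_irr : {in S, forall v, v \notin N v}.

(** Component [i0] carries the extra edge and takes one piece more. The other paths use pieces that
    avoid [y1] and [y2], so [link_arc_from] keeps all their edges. *)
Lemma rainbow_paths (I : finType) (u p : I -> nat) (i0 : I) :
  \sum_i u i <= #|A| -> (\sum_i (u i).+1).+1 <= #|X| ->
  (forall i, i != i0 -> p i <= capacity j (u i)) ->
  p i0 <= capacity j (u i0) + j ->
  exists y1 y2 (P : I -> seq V), [/\ [/\ y1 \in S, y2 \in S & y1 != y2],
    forall i, [/\ sorted (link N c S y1 y2) (P i), uniq (P i) & p i <= size (P i)] &
    forall i i' v, v \in P i -> v \in P i' -> i = i'].
Proof.
rewrite (bigD1 i0) //= (bigD1 (P := xpredT) i0) //= => su sx pc p0.
pose l := [seq i <- enum I | i != i0].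
have lE i : (i \in l) = (i != i0) by rewrite mem_filter mem_enum andbT.
have sumE (f : I -> nat) : \sum_(i | i != i0) f i = \sum_(i <- l) f i.
  by rewrite big_filter big_enum_cond.
rewrite !sumE in su sx.
have sh : size (take (u i0) (enum A)) = u i0.
  by rewrite size_takel // -cardE; apply: leq_trans su; apply: leq_addr.
have sxs : size (take (u i0).+2 (enum X)) = (u i0).+2.
  by rewrite size_takel // -cardE; apply: leq_trans sx; rewrite !addSn !ltnS leq_addr.
have hA : {subset enum A <= A} by move=> v; rewrite mem_enum.
have xX : {subset enum X <= X} by move=> v; rewrite mem_enum.
have [|||||y1 [y2 [L [ys yb [pL uL] sL szL]]]] := extra_path j_gt0 Qdisj Qpiece
   NS QS c_inj c_own N_irr (hs := take (u i0) (enum A)) (xs := take (u i0).+2 (enum X)).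
- exact: take_uniq (enum_uniq _).
- by move=> v /mem_take/hA.
- exact: take_uniq (enum_uniq _).
- by move=> v /mem_take/xX.
- by rewrite sh sxs.
have [|||||||P [HP dP]] := @disjoint_paths I u p l (drop (u i0) (enum A))
  (drop (u i0).+2 (enum X)) (filter_uniq _ (enum_uniq _)).
- exact: drop_uniq (enum_uniq _).
- by move=> v /mem_drop/hA.
- exact: drop_uniq (enum_uniq _).
- by move=> v /mem_drop/xX.
- by rewrite size_drop -cardE; lia.
- rewrite size_drop -cardE; lia.
- by move=> i; rewrite lE; apply: pc.
have out v : v \in region (take (u i0) (enum A)) (take (u i0).+2 (enum X)) ->
    v \in region (drop (u i0) (enum A)) (drop (u i0).+2 (enum X)) -> False.
  exact: region_split (enum_uniq _) hA (enum_uniq _) xX.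
have sd i v : i != i0 -> v \in P i -> v \notin L.
  rewrite -lE => il vP; apply/negP => /sL vL; have [_ _ _ sP] := HP i il.
  exact: (out v vL (sP v vP)).
have [y1S y2S y12] := ys; case/andP: yb => y1b y2b.
have ynb y : y \in body Q (take (u i0).+2 (enum X)) ->
    y \notin body Q (drop (u i0).+2 (enum X)).
  by move=> h; apply/negP => h'; apply: (out y); apply/orP; right.
exists y1, y2, (fun i => if i == i0 then L else P i); split=> //.
- move=> i; case: eqP => [->|/eqP ii]; first by split=> //; apply: leq_trans szL; rewrite sh.
  have [|pP uP szP _] := HP i; first by rewrite lE.
  split=> //; apply: sub_sorted pP; apply: link_arc_from => //; try exact: ynb.
  by apply/subsetP => v /bodyP[x /mem_drop/xX xx]; apply: (subsetP (QS xx)).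
- move=> i1 i2 v; case: eqP => [->|/eqP h1]; case: eqP => [->|/eqP h2] //.
  + by move=> vL /(sd _ _ h2); rewrite vL.
  + by move=> /(sd _ _ h1)/negPf->.
  + by apply: dP; rewrite lE.
Qed.
End Forest.

(** * Distribution of the hubs among the components *)

Lemma allocation (I : finType) (p : I -> nat) j h :
  0 < j -> j + h = \sum_i (p i)./2 -> (forall i, 1 < p i) ->
  (exists i, ~~ odd (p i)) ->
  exists (u : I -> nat) i0, [/\ \sum_i u i <= h,
    forall i, i != i0 -> p i <= capacity j (u i) &
    p i0 <= capacity j (u i0) + j].
Proof.
move=> j0 jh p2 [ie pe].
have capE m : 0 < m -> capacity j m = (2 * (j + m)).-1 by case: m.
have half_gt0 i : 0 < (p i)./2 by have := p2 i; lia.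
(* In component [i], [(p i)./2] hubs always suffice; as these halves sum to [j + h], [j] hubs have
   to be saved. *)
have full i : p i <= capacity j (p i)./2.
  by rewrite capE //; have := p2 i; lia.
have [/existsP[i0 /andP[p0 jp]]|/existsPn small] :=
  boolP [exists i, ~~ odd (p i) && (j <= (p i)./2)].
  (* As [p i0] is even, the extra edge saves all [j] hubs on this one component. *)
  exists (fun i => if i == i0 then (p i)./2 - j else (p i)./2), i0; split.
  - move: jh; rewrite (bigD1 i0) //= (bigD1 (P := xpredT) i0) //= eqxx.
    rewrite [X in _ + X <= _](eq_bigr (fun i => (p i)./2)); last first.
      by move=> i /negPf->.
    by set t := \sum_(i | _) _; lia.
  - by move=> i /negPf->.
  - rewrite eqxx; case: (posnP ((p i0)./2 - j)) => [m0|m0]; first by rewrite m0 /=; lia.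
    by rewrite capE //; lia.
have {}small i : ~~ odd (p i) -> (p i)./2 < j.
  by move=> pi; have := small i; rewrite pi /= -ltnNge.
have [/existsP[i1 jp]|/existsPn smallj] := boolP [exists i, j <= (p i)./2].
  (* The even component takes the extra edge and no hub, saving at least one; [p i1] is odd, and
     [i1] saves [j.-1] because [2 * ((p i1)./2 + 1) - 1 = p i1]. *)
  have ie1 : i1 != ie by apply: contraTneq jp => ->; rewrite -ltnNge small.
  exists (fun i => if i == ie then 0 else if i == i1 then (p i)./2 - j.-1 else (p i)./2), ie.
  split.
  - move: jh; rewrite (bigD1 ie) //= (bigD1 i1) //=.
    rewrite (bigD1 (P := xpredT) ie) //= (bigD1 (P := fun i => i != ie) i1) //=.
    rewrite !eqxx (negPf ie1).
    rewrite [X in _ + (_ + X) <= _](eq_bigr (fun i => (p i)./2)); last first.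
      by move=> i /andP[/negPf-> /negPf->].
    by have := half_gt0 ie; set t := \sum_(i | _) _; lia.
  - move=> i /negPf->; case: eqP => [->|_]; last exact: full.
    by rewrite capE; lia.
  - by rewrite eqxx /=; have := small ie pe; lia.
have {}smallj i : (p i)./2 < j by rewrite ltnNge smallj.
(* All halves are now below [j], so one hub is enough for a component, and none is needed for at
   most [j] vertices. *)
pose long i := j < p i.
have [/existsP[i0 l0]|/existsPn none] := boolP [exists i, long i]; last first.
  exists (fun=> 0), ie; split; first by rewrite sum_nat_const muln0.
    by move=> i _; rewrite /= leqNgt; apply: none.
  by rewrite /=; have := smallj ie; lia.
exists (fun i => if i == i0 then 0 else long i : nat), i0; split.
(* A long component has [j <= 2 * (p i)./2], and the even one provides the summand 1. As [2 <= j],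
   this leaves at most [h] long components besides [i0]. *)
- have twice : (\sum_i long i) * j + 1 <= 2 * \sum_i (p i)./2.
    rewrite big_distrl big_distrr /= (bigD1 ie) //= [X in _ <= X](bigD1 ie) //=.
    rewrite addnAC leq_add //.
      by have := p2 ie; rewrite /long; case: ltnP => /=; lia.
    apply: leq_sum => i _; have := p2 i; rewrite /long; case: ltnP => /=; lia.
  rewrite (bigD1 (P := xpredT) i0) //= eqxx.
  rewrite (eq_bigr (fun i => long i : nat)); last by move=> i /negPf->.
  move: twice; rewrite (bigD1 i0) //= l0 -jh; set t := \sum_(i | _) _.
  have := smallj i0; have := half_gt0 i0; nia.
- move=> i /negPf->; rewrite /long; case: ltnP => [_|//].
  by rewrite capE //; have := smallj i; lia.
- by rewrite eqxx /=; have := smallj i0; lia.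
Qed.

(** * From disjoint paths to a rainbow copy of the forest *)

Section Embedding.
Variables (k : nat) (p : 'I_k -> nat) (n : nat).
Let V := vertex (complete_graph n).

Lemma forest_embedding (c : edge_coloring (complete_graph n)) (g : rel V) (x0 : V)
    (P : 'I_k -> seq V) :
  symmetric g ->
  (forall u v u' v', g u v -> g u' v' -> c [set u; v] = c [set u'; v'] ->
     [set u; v] = [set u'; v']) ->
  (forall i, [/\ sorted g (P i), uniq (P i) & p i <= size (P i)]) ->
  (forall i i' v, v \in P i -> v \in P i' -> i = i') ->
  exists f : linear_forest p -> complete_graph n, embedding f /\ rainbow c f.
Proof.
move=> g_sym c_inj HP dP.
(* By [szP] the index stays in range, so the default [x0] is never returned. *)
pose f (x : linear_forest p) : complete_graph n := nth x0 (P (tag x)) (tagged x).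
have szP (x : linear_forest p) : tagged x < size (P (tag x)).
  by have [_ _] := HP (tag x); apply: leq_trans; apply: ltn_ord.
have f_inj : injective f.
  move=> x y fxy; have ixy : tag x = tag y.
    apply: (dP _ _ (f x)); first by rewrite mem_nth ?szP.
    by rewrite fxy mem_nth ?szP.
  move: x y ixy fxy (szP x) (szP y) => [i a] [i' b] /= ii; subst i'.
  rewrite /f /= => E sa sb; congr existT; apply/val_inj/eqP.
  have [_ uP _] := HP i.
  by rewrite -(nth_uniq x0 sa sb uP) E eqxx.
have f_adj x y : adj x y -> g (f x) (f y).
  move: x y => [i a] [i' b] /andP[/eqP /= ii]; subst i'; rewrite tagged_asE /=.
  have [sP _ _] := HP i.
  have step (d : nat) (e : 'I_(p i)) : d.+1 = e -> g (nth x0 (P i) d) (nth x0 (P i) e).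
    move=> de; rewrite -de; apply/(sortedP x0) => //; rewrite de.
    exact: (szP (existT _ i e)).
  by rewrite /f /= => /orP[]/eqP ab; [|rewrite g_sym]; apply: step.
exists f; split; first split=> // u v uv.
  rewrite /= /complete_adj; apply: contraTneq uv => /f_inj ->.
  by rewrite adj_irr.
move=> e e' /imsetP[[u v] uv ->] /imsetP[[u' v'] uv' ->] cE.
rewrite !inE /= in uv uv'; apply: (imset_inj f_inj).
move: cE; rewrite /= !imsetU1 !imset_set1; apply: c_inj; exact: f_adj.
Qed.

End Embedding.

(** * Palettes, owned colors and the upper bound *)

Definition pairs (V : finType) (S : {set V}) : {set {set V}} :=
  [set e : {set V} | (e \subset S) && (#|e| == 2)].

Definition palette (V : finType) (c : {set V} -> nat) (S : {set V}) : seq nat :=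
  undup [seq c e | e <- enum (pairs S)].

(** The colors owned by [v] within [S]: those that vanish when [v] is deleted. *)
Definition own_palette (V : finType) (c : {set V} -> nat) (S : {set V}) (v : V) : seq nat :=
  undup [seq c [set v; w] |
    w <- enum [set w in S :\ v | c [set v; w] \notin palette c (S :\ v)]].

Lemma pairsP (V : finType) (S e : {set V}) :
  reflect (exists x y, [/\ x \in S, y \in S, x != y & e = [set x; y]]) (e \in pairs S).
Proof.
rewrite inE; apply: (iffP idP) => [/andP[eS /cards2P[x [y [xy eE]]]]|].
  have [xe ye] : x \in e /\ y \in e by rewrite eE !inE !eqxx orbT.
  by exists x, y; split=> //; apply: (subsetP eS).
case=> x [y [xS yS xy ->]].
by rewrite subUset !sub1set xS yS cards2 xy.
Qed.

Lemma paletteP (V : finType) (c : {set V} -> nat) (S : {set V}) a :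
  reflect (exists x y, [/\ x \in S, y \in S, x != y & a = c [set x; y]]) (a \in palette c S).
Proof.
rewrite mem_undup; apply: (iffP mapP) => [[e]|[x [y [xS yS xy ->]]]].
  by rewrite mem_enum => /pairsP[x [y [xS yS xy ->]]] ->; exists x, y.
by exists [set x; y] => //; rewrite mem_enum; apply/pairsP; exists x, y.
Qed.

Lemma edges_complete n : edges (complete_graph n) = pairs setT.
Proof.
apply/setP => e; apply/imsetP/pairsP => [[[x y]]|[x [y [_ _ xy ->]]]].
  by rewrite inE => xy ->; exists x, y; rewrite !inE.
by exists (x, y) => //; rewrite inE.
Qed.

Lemma num_colors_palette n (c : edge_coloring (complete_graph n)) :
  num_colors c = size (palette c setT).
Proof. by rewrite /num_colors /palette -edges_complete. Qed.

Lemma palette_size (V : finType) (c : {set V} -> nat) (S : {set V}) :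
  size (palette c S) <= 2 ^ #|S|.
Proof.
rewrite (leq_trans (size_undup _)) // size_map -cardE -card_powerset.
by apply/subset_leq_card/subsetP => e; rewrite !inE => /andP[].
Qed.

Lemma palette_delete (V : finType) (c : {set V} -> nat) (S : {set V}) v :
  size (palette c S) <= size (palette c (S :\ v)) + size (own_palette c S v).
Proof.
rewrite -size_cat; apply: uniq_leq_size; first exact: undup_uniq.
move=> a /paletteP[x [y [xS yS xy ->]]]; rewrite mem_cat.
have [//|np] := boolP (_ \in palette c (S :\ v)).
have own w : w \in S -> w != v -> c [set v; w] \notin palette c (S :\ v) ->
    c [set v; w] \in own_palette c S v.
  move=> wS wv nw; rewrite mem_undup; apply/mapP; exists w => //.
  by rewrite mem_enum !inE wv wS nw.
have [xv|xv] := eqVneq x v.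
  by subst x; apply: own; rewrite // eq_sym.
have [yv|yv] := eqVneq y v.
  by subst y; rewrite setUC in np *; apply: own.
by case/paletteP: np; exists x, y; rewrite !inE xv yv.
Qed.

Lemma distinct_colors (T : finType) (f : T -> nat) (W : {set T}) d :
  d <= size (undup [seq f w | w <- enum W]) ->
  exists B : {set T}, [/\ B \subset W, #|B| = d & {in B &, injective f}].
Proof.
elim: d => [|d IH] dW.
  by exists set0; split; rewrite ?sub0set ?cards0 // => x y; rewrite inE.
have [B [BW cB iB]] := IH (ltnW dW).
have [/allP sub|/allPn[a]] :=
  boolP (all (fun a => a \in [seq f w | w <- enum B]) (undup [seq f w | w <- enum W])).
  have := uniq_leq_size (undup_uniq _) sub; rewrite size_map -cardE cB.
  by rewrite leqNgt dW.
rewrite mem_undup => /mapP[w]; rewrite mem_enum => wW -> nB.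
have fB x : x \in B -> f x != f w.
  by move=> xB; apply: contra nB => /eqP<-; apply: map_f; rewrite mem_enum.
exists (w |: B); split.
- by rewrite subUset sub1set wW.
- by rewrite cardsU1 cB; case: (boolP (w \in B)) => [/fB|]; rewrite ?eqxx.
- move=> x y /setU1P[->|xB] /setU1P[->|yB] //; last exact: iB.
    by move=> E; move: (fB y yB); rewrite E eqxx.
  by move=> E; move: (fB x xB); rewrite E eqxx.
Qed.

(** Choosing [s.-1] owned colors at every vertex of [S] defines the digraph [N]; its pieces, with
    the hubs distributed by [allocation], yield the paths of the forest. *)
Lemma rainbow_of_own_colors k (p : 'I_k -> nat) :
  (forall i, 1 < p i) -> (exists i, ~~ odd (p i)) ->
  exists n0, forall n (c : edge_coloring (complete_graph n)) (S : {set complete_graph n}),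
    {in S, forall v, (\sum_i (p i)./2).-1 <= size (own_palette c S v)} ->
    n0 <= #|S| ->
    exists f : linear_forest p -> complete_graph n, embedding f /\ rainbow c f.
Proof.
move=> p2 pe; set s := \sum_i _.
have s_gt0 : 0 < s.
  case: pe => i _; rewrite /s (bigD1 i) //=; have := p2 i; lia.
(* The out-degree is [s.-1]. The pieces must cover [\sum_i (u i).+1] and one more for the extra
   edge, where the [u i] sum to less than [s]. *)
have [n0 Hn0] := pieces_exist s.-1 (s + k).+1.
exists n0 => n c S HS nS.
(* Stated for every [v] so that choice yields a total [N], arbitrary outside [S]. *)
have exN v : exists B : {set complete_graph n}, v \in S ->
   [/\ B \subset [set w in S :\ v | c [set v; w] \notin palette c (S :\ v)],
       #|B| = s.-1 & {in B &, injective (fun w => c [set v; w])}].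
  have [vS|vS] := boolP (v \in S); last by exists set0.
  by have [B HB] := distinct_colors (HS v vS); exists B.
have [N HN] := fin_all_exists exN.
have NE v w : v \in S -> w \in N v ->
    [/\ w \in S, w != v & c [set v; w] \notin palette c (S :\ v)].
  move=> vS; have [sub _ _] := HN v vS.
  by move/(subsetP sub); rewrite !inE => /andP[/andP[]].
have NS : {in S, forall v, N v \subset S}.
  by move=> v vS; apply/subsetP => w /(NE v w vS)[].
have N_irr : {in S, forall v, v \notin N v}.
  by move=> v vS; apply/negP => /(NE v v vS)[]; rewrite eqxx.
have [||A [X [Q [j [j0 jA TX dQ HQ]]]]] := Hn0 _ N S.
- by move=> v vS; have [_ cN _] := HN v vS; split; [exact: NS|exact: N_irr|].
- exact: nS.
have [|u [i0 [su pu p0]]] := allocation (p := p) (h := minn #|A| s.-1) j0 _ p2 pe.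
  by rewrite jA prednK.
(* A color absent from [S :\ x] occurs only on pairs of [S] that contain [x]. *)
have c_own x y z t : x \in S -> y \in N x -> z \in S -> t \in S ->
    z != t -> c [set x; y] = c [set z; t] -> (x == z) || (x == t).
  move=> xS yN zS tS zt cE; have [_ _] := NE x y xS yN; apply: contraR.
  rewrite negb_or ![x == _]eq_sym => /andP[zx tx].
  by apply/paletteP; exists z, t; rewrite !inE zx tx.
have c_inj : {in S, forall u, {in N u &, injective (fun v => c [set u; v])}}.
  by move=> v vS; have [] := HN v vS.
have QS : {in X, forall x, Q x \subset S} by move=> x /HQ[].
have Qpiece : {in X, forall x, piece N j A (Q x)} by move=> x /HQ[].
have [||y1 [y2 [P [[y1S y2S y12] HP dP]]]] :=
  rainbow_paths j0 dQ Qpiece NS QS c_inj c_own N_irr (u := u) _ _ pu p0.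
- by apply: leq_trans su _; apply: geq_minl.
- apply: leq_trans TX; rewrite ltnS (eq_bigr (fun i => u i + 1)); last first.
    by move=> i _; rewrite addn1.
  rewrite big_split /= sum_nat_const card_ord muln1 leq_add2r.
  by apply: leq_trans su _; apply: leq_trans (geq_minr _ _) (leq_pred _).
apply: (forest_embedding y1 (link_sym N c S y1 y2)) HP dP => a b a' b'.
exact: (link_color_inj NS c_inj c_own N_irr).
Qed.

(* Written additively because s - 2 would be truncated at s = 1. *)
Lemma palette_linear k (p : 'I_k -> nat) :
  (forall i, 1 < p i) -> (exists i, ~~ odd (p i)) ->
  exists C, forall n (c : edge_coloring (complete_graph n)),
    rainbow_free (linear_forest p) c -> forall S : {set complete_graph n},
    size (palette c S) + 2 * #|S| <= (\sum_i (p i)./2) * #|S| + C.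
Proof.
move=> p2 pe; have [n0 Hn0] := rainbow_of_own_colors p2 pe; set s := \sum_i _ in Hn0 *.
(* For fewer than [n0] vertices, [2 ^ n0] bounds the palette and [2 * n0] the summand [2 * #|S|]. *)
exists (2 ^ n0 + 2 * n0) => n c free S.
move: {2}#|S| (leqnn #|S|) => m; elim: m S => [|m IH] S Sm.
  have := palette_size c S; move: Sm; rewrite leqn0 => /eqP->.
  by rewrite !muln0 addn0 add0n => h; apply: leq_trans h _; rewrite expn0 addn_gt0 expn_gt0.
have [Sn0|n0S] := ltnP #|S| n0.
  rewrite addnC [X in _ <= X]addnC -addnA addnC leq_add //.
    apply: leq_trans (palette_size c S) _; rewrite leq_exp2l //; exact: ltnW.
  by rewrite (leq_trans _ (leq_addr _ _)) // leq_mul2l ltnW.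
(* Without such a [v] a rainbow forest exists. Deleting [v] loses at most [s - 2] colors, and [own]
   forces [2 <= s], so nothing is truncated. *)
have [/existsP[v /andP[vS own]]|/existsPn none] :=
  boolP [exists v in S, size (own_palette c S v) < s.-1]; last first.
  case: free; apply: (Hn0 n c S) n0S => v vS.
  by have := none v; rewrite vS /= -leqNgt.
have cS : #|S| = #|S :\ v|.+1 by rewrite (cardsD1 v) vS.
have := IH (S :\ v); rewrite -ltnS -cS Sm => /(_ isT).
have := palette_delete c S v; rewrite cS; move: own.
move: (size _) (size _) (size _) (#|_|) => o a b l.
move: (2 ^ n0); clear; nia.
Qed.

(** * The lower bound by a coloring with a few dominating vertices *)

Section LowerBound.
Variables (k : nat) (p : 'I_k -> nat).

Fact matching_proof (x : {i : 'I_k & 'I_(p i)./2}) (b : bool) :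
  (tagged x).*2 + b < p (tag x).
Proof. by have := ltn_ord (tagged x); case: b; lia. Qed.

(** Pairing the vertices [2d] and [2d + 1] of each path gives a matching with [\sum_i (p i)./2]
    edges. *)
Definition matching_end (x : {i : 'I_k & 'I_(p i)./2}) (b : bool) : linear_forest p :=
  Tagged (fun i => 'I_(p i)) (Ordinal (matching_proof x b)).

Definition matching_edge x : {set linear_forest p} :=
  [set matching_end x false; matching_end x true].

Lemma matching_edge_in x : matching_edge x \in edges (linear_forest p).
Proof.
apply/imsetP; exists (matching_end x false, matching_end x true) => //.
by rewrite inE /= /union_adj eqxx tagged_asE /= /path_adj /= addn0 addn1 eqxx.
Qed.

Lemma matching_edge_inj x y v : v \in matching_edge x -> v \in matching_edge y -> x = y.
Proof.
have half z b : v = matching_end z b -> tag v = tag z /\ (tagged v)./2 = tagged z :> nat.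
  by move=> ->; split=> //=; case: b; lia.
have memE z : v \in matching_edge z -> exists b, v = matching_end z b.
  by rewrite !inE => /orP[]/eqP->; [exists false|exists true].
move=> /memE[b /half[tx hx]] /memE[b' /half[ty hy]].
move: x y tx ty hx hy => [i d] [i' d'] /= ti ti' di di'.
subst i i'.
suff -> : d = d' by [].
by apply/val_inj; rewrite /= -di -di'.
Qed.

(** Counting only the edges between [A] and its complement loses an amount that depends on [t]
    alone. *)
Lemma many_colors n t : t <= n -> t.+1 < \sum_i (p i)./2 ->
  exists c : edge_coloring (complete_graph n),
    rainbow_free (linear_forest p) c /\ t * (n - t) <= num_colors c.
Proof.
move=> tn ts; pose V := vertex (complete_graph n).
pose A : {set V} := [set x in take t (enum V)].
have cA : #|A| = t.
  rewrite cardsE; have /card_uniqP-> := take_uniq t (enum_uniq V).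
  by rewrite size_takel // -cardE card_ord.
(* The successor keeps the distinct colors of the edges meeting [A] apart from the common color
   0. *)
pose c (e : {set V}) : nat := if [disjoint e & A] then 0 else (enum_rank e).+1.
exists c; split.
  case=> f [[f_inj f_adj] rf].
  (* [g] picks a vertex of [A] on the image of a matching edge, or [None]. It is injective, since
     these images are disjoint and at most one has color 0; so the matching has at most [t + 1]
     edges. *)
  pose g (x : {i : 'I_k & 'I_(p i)./2}) : option V :=
    [pick v in (f @: matching_edge x) :&: A].
  have gP x y : g x = g y -> x = y.
    rewrite /g; case: pickP => [v /setIP[vx _]|nx]; case: pickP => [w /setIP[wy _]|ny] //.
      case=> vw; case/imsetP: vx => v1 v1x; rewrite vw; case/imsetP: wy => v2 v2y ->.
      by move=> /f_inj E; apply: (matching_edge_inj v1x); rewrite -E.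
    move=> _; have c0 z : (forall v, v \in (f @: matching_edge z) :&: A = false) ->
        c (f @: matching_edge z) = 0.
      move=> nz; rewrite /c ifT //; apply/pred0P => v.
      by have := nz v; rewrite inE.
    have /(matching_edge_inj (set21 _ _)) : matching_end x false \in matching_edge y.
      rewrite -(rf _ _ (matching_edge_in x) (matching_edge_in y)) ?set21 //.
      by rewrite !c0.
    exact.
  have g_sub : [set g x | x in setT] \subset None |: [set Some v | v in A].
    apply/subsetP => _ /imsetP[x _ ->]; rewrite /g; case: pickP => [v /setIP[_ vA]|_].
      by rewrite !inE; apply/orP; right; apply: imset_f.
    exact: setU11.
  have := subset_leq_card g_sub; rewrite card_imset //.
  have -> : #|[set: {i : 'I_k & 'I_(p i)./2}]| = \sum_i (p i)./2.
    rewrite cardsT card_tagged sumnE big_map big_enum /=.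
    by apply: eq_big => // i _; rewrite card_ord.
  rewrite cardsU1 card_imset; last by move=> ? ? [].
  by rewrite cA; case: (_ \notin _); move: ts; clear; lia.
pose E := [set [set u.1; u.2] | u in setX A (~: A)].
have cE : #|E| = t * (n - t).
  have cC : #|~: A| = n - t by have := cardsC A; rewrite cA card_ord; lia.
  rewrite card_in_imset; first by rewrite cardsX cA cC.
  move=> [a b] [a' b'] /setXP[/= aA]; rewrite inE => bA /setXP[/= aA'].
  rewrite inE => bA' /setP eqE; congr pair.
    have := eqE a; rewrite !inE eqxx /= => /esym/orP[/eqP//|/eqP ab].
    by move: bA'; rewrite -ab aA.
  have := eqE b; rewrite !inE eqxx orbT => /esym/orP[/eqP ab|/eqP//].
  by move: bA; rewrite ab aA'.
have sE : {subset E <= edges (complete_graph n)}.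
  move=> e /imsetP[[a b] /setXP[/= aA bA] ->]; rewrite inE in bA.
  apply/imsetP; exists (a, b) => //; rewrite inE /= /complete_adj.
  by apply: contraNneq bA => <-.
rewrite -cE cardE -(size_map c); apply: uniq_leq_size.
  rewrite map_inj_in_uniq ?enum_uniq // => e e'; rewrite !mem_enum => eE eE'.
  have nd z : z \in E -> [disjoint z & A] = false.
    case/imsetP=> [[a b] /setXP[/= aA _] ->].
    by apply/negP => /pred0P/(_ a); rewrite /= aA set21.
  by rewrite /c !nd // => -[] /val_inj/enum_rank_inj.
move=> _ /mapP[e eE ->]; rewrite mem_undup; apply: map_f.
by rewrite mem_enum; apply: sE; rewrite -mem_enum.
Qed.
End LowerBound.

(** * The two bounds combined over the integers *)

Import Order.TTheory GRing.Theory Num.Theory.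
Local Open Scope ring_scope.

Theorem theorem12 (k : nat) (p : 'I_k -> nat)
    (hk : (1 <= k)%N) (hp : forall i : 'I_k, (2 <= p i)%N)
    (heven : exists i : 'I_k, ~~ odd (p i)) :
  exists C : nat, forall n a : nat, is_anti_ramsey n (linear_forest p) a ->
    `|a%:Z - ((\sum_(i < k) (p i)./2)%N%:Z - 2%:Z) * n%:Z| <= C%:Z.
Proof.
have [C HC] := palette_linear hp heven; set s := (\sum_i _)%N in HC *.
(* [C] comes from the upper bound, and [s * s] covers the loss of at most [(s - 2)^2] in the lower
   one. *)
exists (C + s * s)%N => n a [[c [free <-]] maxa].
have := HC n c free setT; rewrite -num_colors_palette cardsT card_ord => up.
have low : ((s - 2) * (n - (s - 2)) <= num_colors c)%N.
  (* Truncated subtraction makes the bound trivial for [s < 2] and for [n < s - 2]. *)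
  have [s2|s2] := leqP 2 s; last by have -> : (s - 2 = 0)%N by lia.
  have [tn|tn] := leqP (s - 2) n; last by rewrite (_ : (n - (s - 2) = 0)%N) ?muln0 //; lia.
  have [|d [fd cd]] := @many_colors k p n (s - 2) tn; first by rewrite -/s; lia.
  exact: leq_trans cd (maxa d fd).
move: (num_colors c) up low => b up low; clear - up low.
nia.
Qed.
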